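(* Let $n,p\geq 2$ be integers. Then the maps $\Psi_n^p:E(\mathcal{T}_n^p)\to \mathrm{MI}_n^p$ and $\Phi_n^p:\mathrm{MI}_n^p\to E(\mathcal{T}_n^p)$ defined in the context are mutually inverse bijections between the edge set of the $(n,p)$-Turán graph and the set of meet-irreducible elements of the lattice $\mathbb{F}_n^p$ of compositions of $n$ with parts in $[1,p]$ under the dominance order.
   Context: **Turán graph.** For integers $n,p$, $\mathcal{T}_n^p$ is the graph with vertex set $\{1,\ldots,n\}$ in which $\{a,b\}$ is an edge if and only if $a\not\equiv b \bmod p$. $E(\mathcal{T}_n^p)$ denotes its edge set. **Compositions and dominance order.** A composition of $n\ge 1$ is a tuple $(x_1,\ldots,x_m)$ of positive integers with $m\geq 1$ and $x_1+\cdots+x_m=n$. $\mathbb{F}_n^p$ is the set of compositions of $n$ all of whose parts satisfy $1\leq x_i\leq p$. It is ordered by the dominance order: $(x_1,\ldots,x_m)\leq (y_1,\ldots,y_\ell)$ iff $\sum_{i=1}^k x_i\leq\sum_{i=1}^k y_i$ for all $1\leq k\leq\min(m,\ell)$. With this order $\mathbb{F}_n^p$ is a finite distributive lattice. An element $y$ is an upper cover of $x$ if $x<y$ and $x\le z\le y$ implies $z\in\{x,y\}$. $\mathrm{MI}_n^p$ is the set of meet-irreducible elements of $\mathbb{F}_n^p$, i.e. the elements having exactly one upper cover in $\mathbb{F}_n^p$. Throughout, $r \bmod p$ denotes the remainder in $\{0,\ldots,p-1\}$, and ''$x$ ends by $uv$'' means that the last two parts of $x$ are $u,v$ in this order. **The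 map $f$.** For a composition $x=(x_1,\ldots,x_m)$ of $n-1$ with parts in $[1,p]$, $f(x)=(x_1,\ldots,x_{m-1},x_m+1)$ if $1\leq x_m<p$, and $f(x)=(x_1,\ldots,x_m,1)$ if $x_m=p$. This map restricts to a map $\mathrm{MI}_{n-1}^p\to\mathrm{MI}_n^p$. **The map $\Psi_n^p$.** It is defined recursively on $n$: for $\{a,b\}\in E(\mathcal{T}_n^p)$ with $a<b$, $$\Psi_n^p(a,b)=\begin{cases} f(\Psi_{n-1}^p(a,b)) & \text{if } b<n,\\ (\underbrace{p,\ldots,p}_{\lfloor (n-a)/p\rfloor},\,(n-a)\bmod p,\,\underbrace{1,\ldots,1}_{a}) & \text{if } b=n.\end{cases}$$ **The map $\Phi_n^p$.** For $x\in \mathrm{MI}_n^p$, let $k_x\geq 0$, $1\leq i_x\leq p-1$ and $m_x\geq 0$ be such that $x$ starts with $\underbrace{p,\ldots,p}_{k_x},i_x,\underbrace{1,\ldots,1}_{m_x}$, with $m_x$ maximal (so $k_x$ is the number of leading parts equal to $p$, $i_x$ is the next part, and $m_x$ is the number of consecutive parts equal to $1$ immediately following $i_x$); these exist for every $x\in\mathrm{MI}_n^p$. Let $\delta_x=1$ if either $x$ does not end by $1$ or $x$ ends by $p1$, and $\delta_x=0$ otherwise. Then $$\Phi_n^p(x)=\{\,m_x+\delta_x,\ p k_x+i_x+m_x+\delta_x\,\}.$$ *)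

(* Defs.v *)
From mathcomp Require Import all_boot finmap.
From mathcomp Require Import classical_sets functions.

Set Implicit Arguments.
Unset Strict Implicit.
Unset Printing Implicit Defensive.

Local Open Scope classical_set_scope.
Local Open Scope nat_scope.

(* An edge is the unordered pair of its endpoints, as a finite set of nats;
   vertices range over {1, ..., n}. *)
Definition turan_edges (n p : nat) : set {fset nat} :=
  [set e | exists a b : nat,
     [/\ 1 <= a <= n, 1 <= b <= n, a <> b %[mod p] & e = [fset a; b]%fset]].

Definition compositions (n p : nat) : set (seq nat) :=
  [set x | [/\ x <> [::], all (fun i => 1 <= i <= p) x & sumn x = n]].

Definition dominance (x y : seq nat) : Prop :=
  forall k, 1 <= k <= minn (size x) (size y) ->
    sumn (take k x) <= sumn (take k y).

Definition upper_cover (n p : nat) (x y : seq nat) : Prop :=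
  [/\ compositions n p y, x <> y, dominance x y &
      forall z, compositions n p z -> dominance x z -> dominance z y ->
        z = x \/ z = y].

Definition meet_irreducibles (n p : nat) : set (seq nat) :=
  [set x | compositions n p x /\ exists! y, upper_cover n p x y].

(* The value on the empty sequence, which is not a composition, is junk. *)
Definition f_ (p : nat) (x : seq nat) : seq nat :=
  if x is i :: s then
    if last i s < p then rcons (belast i s) (last i s).+1 else rcons x 1
  else [::].

(* Only meaningful for 1 <= a < b <= n. *)
Fixpoint psi (n p a b : nat) : seq nat :=
  if n is n'.+1 then
    if b < n then f_ p (psi n' p a b)
    else nseq ((n - a) %/ p) p ++ (n - a) %% p :: nseq a 1
  else [::].

(* Sorting recovers the endpoints a < b of an edge. *)
Definition Psi (n p : nat) (e : {fset nat}) : seq nat :=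
  if sort leq e is [:: a; b] then psi n p a b else [::].

Definition k_ (p : nat) (x : seq nat) : nat := find (predC1 p) x.
Definition i_ (p : nat) (x : seq nat) : nat := nth 0 x (k_ p x).
Definition m_ (p : nat) (x : seq nat) : nat :=
  find (predC1 1) (drop (k_ p x).+1 x).
Definition delta_ (p : nat) (x : seq nat) : nat :=
  (last 0 x != 1) || suffix [:: p; 1] x.

Definition Phi (p : nat) (x : seq nat) : {fset nat} :=
  [fset (m_ p x + delta_ p x)%N;
        (p * k_ p x + i_ p x + m_ p x + delta_ p x)%N]%fset.

(* Main.v *)
(** The upper covers of a composition [x] are exactly the compositions obtained
    from it by moving one unit from a part to the preceding one (a part equal
    to 1 can only give its unit away, and disappear, when it is the last one).
    Hence [x] is meet-irreducible iff exactly one such move is legal.  No move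
    is legal only at the maximum [(p, ..., p, r)], and a legal move exists as
    soon as some part other than the last one is less than [p]; so the
    meet-irreducible elements are [(p^k, i, 1^a, w)] with [0 < i < p] and [w]
    the maximum of the compositions of some [N + 1].  The map [f] increments
    [N], so both maps can be computed in the coordinates [(k, i, a, N)]: the
    corresponding edge is [{a + 1, p k + i + a + 1}]. *)

Require Import Defs.
From mathcomp Require Import all_boot finmap.
From mathcomp Require Import classical_sets functions.
From mathcomp Require Import zify.

Set Implicit Arguments.
Unset Strict Implicit.
Unset Printing Implicit Defensive.

Local Notation psum x k := (sumn (take k x)).
Local Notation parts p := (all (fun i : nat => 1 <= i <= p)).

(* The maximum of the compositions of [N.+1] with parts in [1, p]. *)
Definition top p N := rcons (nseq (N %/ p) p) (N %% p).+1.

Definition mi p k i a N := nseq k p ++ i :: nseq a 1 ++ top p N.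

(* All results of moving one unit of [x] from a part to the preceding one. *)
Fixpoint raises p (x : seq nat) : seq (seq nat) :=
  if x is u :: x' then
    (if x' is v :: t then
       if (u < p) && ((1 < v) || (v :: t == [:: 1]))
       then [:: u.+1 :: if v == 1 then [::] else v.-1 :: t] else [::]
     else [::]) ++ map (cons u) (raises p x')
  else [::].

Lemma raises_cons2 p u v t :
  raises p [:: u, v & t] =
    (if (u < p) && ((1 < v) || (v :: t == [:: 1]))
     then [:: u.+1 :: if v == 1 then [::] else v.-1 :: t] else [::])
    ++ map (cons u) (raises p (v :: t)).
Proof. by []. Qed.

(** * Partial sums and the dominance order *)

Lemma psum_inj p x y : parts p x -> parts p y ->
  (forall k, psum x k = psum y k) -> x = y.
Proof.
elim: x y => [|u x IH] [|v y] //=.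
- by move=> _ /andP[? _] /(_ 1) /=; rewrite take0 /=; lia.
- by move=> /andP[? _] _ /(_ 1) /=; rewrite take0 /=; lia.
move=> /andP[_ px] /andP[_ py] E.
have Euv : u = v by have := E 1; rewrite /= !take0 /=; lia.
by rewrite Euv (IH y) // => k; have := E k.+1; rewrite /=; lia.
Qed.

Lemma psum_le_sumn x k : psum x k <= sumn x.
Proof. by rewrite -{2}(cat_take_drop k x) sumn_cat leq_addr. Qed.

Lemma leq_psum x k l : k <= l -> psum x k <= psum x l.
Proof. by move=> /take_takel <-; exact: psum_le_sumn. Qed.

(** Parts are positive, so partial sums grow strictly until they reach the total; [minn] covers the
    indices past the end. *)
Lemma psumS p x k : parts p x -> minn (psum x k).+1 (sumn x) <= psum x k.+1.
Proof.
elim: x k => [|u x IH] [|k] //=.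
  by rewrite take0 /= => /andP[]; lia.
by move=> /andP[_ /(IH k)]; lia.
Qed.

Lemma dominanceP n p x y : compositions n p x -> compositions n p y ->
  dominance x y <-> forall k, psum x k <= psum y k.
Proof.
move=> [x0 px sx] [y0 py sy]; split=> [D k|D k _]; last exact: D.
have [yk|ky] := leqP (size y) k.
  by rewrite (take_oversize yk) sy -sx psum_le_sumn.
have [xk|kx] := leqP (size x) k.
  rewrite (take_oversize xk); apply: leq_trans (leq_psum y xk).
  have := D (size x); rewrite take_size; apply.
  by case: (x) x0 xk => //= u s _; lia.
case: k ky kx => [|k] ky kx; first by rewrite !take0.
by apply: D; lia.
Qed.

(** * Upper covers as transfers of one unit *)

Lemma psum_raises p (x y : seq nat) : y \in raises p x ->
  exists j, forall k, psum y k = psum x k + (k == j.+1).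
Proof.
elim: x y => // u [|v t] IH y // ; rewrite raises_cons2 mem_cat => /orP[].
  case: ifP => // /andP[_ H]; rewrite inE => /eqP ->.
  exists 0 => -[|k] //=.
  case: ifP H => [/eqP ->|v1].
    move=> /= /eqP[->]; case: k => [|k] /=; rewrite ?addn0 //=; lia.
  rewrite eqseq_cons v1 orbF; case: k => [|k] H /=; rewrite ?take0 /=; lia.
case/mapP=> z /IH[j E] ->; exists j.+1 => -[|k] //=.
by rewrite E /=; lia.
Qed.

Lemma compositions_raises n p (x y : seq nat) : compositions n p x -> y \in raises p x ->
  compositions n p y.
Proof.
suff H : parts p x -> y \in raises p x ->
    [/\ y <> [::], parts p y & sumn y = sumn x].
  by move=> [_ px sx] /(H px)[y0 py sy]; split=> //; rewrite sy.
elim: x y => // u [|v t] IH y //; rewrite raises_cons2 mem_cat.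
move=> /andP[pu pvt] /orP[].
  case: ifP => // /andP[up H]; rewrite inE => /eqP ->.
  move: pvt => /= /andP[pv pt].
  case: ifP H => [/eqP -> /= /eqP[->]|v1] /=; first by split=> //=; lia.
  by rewrite eqseq_cons v1 orbF => H; split=> //=; rewrite ?[all _ t]pt; lia.
by case/mapP=> z /(IH _ pvt)[z0 pz sz] ->; split=> //=; rewrite ?pu ?sz.
Qed.

(** A transfer into the first part changes that part, all others keep it. This lets the number of
    upper covers be read off as a size. *)
Lemma uniq_raises p x : uniq (raises p x).
Proof.
elim: x => // u [|v t] IH //; rewrite raises_cons2.
rewrite cat_uniq map_inj_uniq ?IH ?andbT; last by move=> ? ? [].
case: ifP => //= _; last by apply/hasPn.
by apply/hasPn => _ /mapP[z _ ->]; rewrite inE; apply/eqP => -[]; lia.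
Qed.

(* A position where [T] is strictly above [u :: x] can be pushed to the right
   along parts equal to 1 until the transfer of a unit becomes legal. *)
Lemma raises_below_strict p u x (T : nat -> nat) :
  1 < p -> u < p -> x <> [::] -> parts p x ->
  (forall k, psum (u :: x) k <= T k) -> u < T 1 ->
  (forall k, minn (T k).+1 (sumn (u :: x)) <= T k.+1) ->
  exists2 z : seq nat, z \in raises p (u :: x) & forall k, psum z k <= T k.
Proof.
move=> p1; elim: x u T => // v t IH u T up _ /andP[pv pt] le_T lt_T T_S.
rewrite raises_cons2.
case: ifP => [H|/negbT].
  exists (u.+1 :: if v == 1 then [::] else v.-1 :: t); first exact: mem_head.
  move=> k; move: (le_T k).
  case: k => [|k] //=; case: k => [|k] /=; first by rewrite !take0 /=; lia.
  by case: ifP H => [/eqP -> /= /andP[_ /eqP[->]]|v1 H] /=; lia.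
rewrite up /= negb_or => /andP[v1].
have {}v1 : v = 1 by lia.
subst v; rewrite eqseq_cons eqxx => /eqP t0.
have st : 0 < sumn t by case: (t) t0 pt => //= a s _ /andP[]; lia.
(* The shifted bound is positive at 0, so it is no sequence of partial sums; hence the arbitrary
   function [T]. Its strictness at 1 comes from [T_S 1], as [t] has positive sum. *)
have [|||z zr zT] := IH 1 (fun k => T k.+1 - u) p1 t0 pt.
- by move=> k; move: (le_T k.+1); case: k => [|k] /=; lia.
- by move: (T_S 1) => /=; lia.
- by move=> k; move: (T_S k.+1) (le_T k.+1); rewrite /=; lia.
exists (u :: z); first by rewrite map_f.
by case=> [|k] //=; move: (zT k) (le_T k.+1) => /=; lia.
Qed.

(** Strip the common prefix; at the first difference [y] has the larger part, and its partial sums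
    serve as the bound [T]. *)
Lemma raises_below p x y : 1 < p -> parts p x -> parts p y ->
  sumn x = sumn y -> x <> y -> (forall k, psum x k <= psum y k) ->
  exists2 z : seq nat, z \in raises p x & forall k, psum z k <= psum y k.
Proof.
move=> p1; elim: x y => [|u x IH] [|w y] //=.
- by move=> _ /andP[]; lia.
- by move=> /andP[? _]; lia.
move=> /andP[pu px] /andP[pw py] sxy nxy D.
have uw : u <= w by have := D 1; rewrite /= !take0 /=; lia.
have [E|{}nuw] := eqVneq u w.
  subst w; have [|||z zr zD] := IH y px py.
  - lia.
  - by move=> E; apply: nxy; rewrite E.
  - by move=> k; have := D k.+1; rewrite /=; lia.
  exists (u :: z); first by rewrite mem_cat map_f ?orbT.
  by case=> [|k] //=; rewrite leq_add2l; exact: zD.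
apply: raises_below_strict => //=; [lia| | by rewrite take0 /=; lia |].
  by move=> x0; move: sxy; rewrite x0 /=; lia.
move=> k; rewrite sxy; apply: (@psumS p (w :: y) k).
by rewrite /= pw.
Qed.

(** Some transfer [z] lies strictly above [x] and below a given cover, hence equals it. Conversely,
    a transfer raises a single partial sum, by 1, which leaves no room in between. *)
Lemma upper_coverE n p (x y : seq nat) : 1 < p -> compositions n p x ->
  upper_cover n p x y <-> y \in raises p x.
Proof.
move=> p1 cx; split.
  case=> cy nxy /(dominanceP cx cy) D U.
  have [_ px sx] := cx; have [_ py sy] := cy.
  have [|z zr zD] := raises_below p1 px py _ nxy D; first by rewrite sx sy.
  have cz := compositions_raises cx zr.
  have [j E] := psum_raises zr.
  have [|| zx|<- //] := U z cz.
  - by apply/(dominanceP cx cz) => k; rewrite E leq_addr.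
  - exact/(dominanceP cz cy).
  - by move: (E j.+1); rewrite zx eqxx; lia.
move=> yr; have cy := compositions_raises cx yr.
have [j E] := psum_raises yr.
split=> //.
- by move=> xy; move: (E j.+1); rewrite xy eqxx; lia.
- by apply/(dominanceP cx cy) => k; rewrite E leq_addr.
move=> z cz /(dominanceP cx cz) D1 /(dominanceP cz cy) D2.
have [_ px sx] := cx; have [_ py sy] := cy; have [_ pz sz] := cz.
have Ez k : k != j.+1 -> psum z k = psum x k.
  by move=> /negPf kj; move: (D1 k) (D2 k); rewrite E kj; lia.
have := D1 j.+1; have := D2 j.+1; rewrite E eqxx => le1 le2.
have [ej|nej] := eqVneq (psum z j.+1) (psum x j.+1); [left|right];
  apply: (@psum_inj p) => // k; have [->|kj] := eqVneq k j.+1 => //.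
- exact: Ez.
- by rewrite E eqxx; lia.
- by rewrite E Ez // (negPf kj) addn0.
Qed.

Lemma meet_irreduciblesE n p x : 1 < p -> compositions n p x ->
  meet_irreducibles n p x <-> size (raises p x) = 1.
Proof.
move=> p1 cx; split.
  case=> _ [y [/(upper_coverE _ p1 cx) yr uy]].
  have := uniq_raises p x.
  case: (raises p x) yr (fun z => iffRL (upper_coverE z p1 cx))
    => [|a [|b s]] //= _ U /andP[]; rewrite inE negb_or => /andP[/eqP ab _] _.
  case: ab; rewrite -(uy a) ?(uy b) //; apply: U; rewrite !inE eqxx ?orbT //.
move=> s1; split=> //.
have : raises p x = [:: head [::] (raises p x)] by case: raises s1 => // a [].
move: (head _ _) => y E; exists y; split; first by apply/upper_coverE; rewrite ?E ?inE.
by move=> z /(upper_coverE _ p1 cx); rewrite E inE => /eqP.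
Qed.

(** * Compositions with no legal transfer, or exactly one *)

Lemma raises_cons_full p x : raises p (p :: x) = map (cons p) (raises p x).
Proof. by case: x => [|v t] //=; rewrite ltnn. Qed.

Lemma top_full p N : 0 < p -> top p (N + p) = p :: top p N.
Proof. by move=> p0; rewrite /top divnDr ?dvdnn // divnn p0 addn1 modnDr. Qed.

Lemma raises_top p N : raises p (top p N) = [::].
Proof.
rewrite /top; elim: (N %/ p) => // q IH.
by rewrite -[rcons _ _]/(p :: rcons (nseq q p) _) raises_cons_full IH.
Qed.

(** By induction the tail is a maximum. If [u < p], an illegal first transfer makes the tail start
    with 1 and have at least two parts, whereas a maximum of that length starts with [p]. *)
Lemma raises_eq0 p x : 1 < p -> parts p x -> x <> [::] -> raises p x = [::] ->
  exists N, x = top p N.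
Proof.
move=> p1; elim: x => // u [|v t] IH /andP[pu px] _.
  move=> _; exists u.-1; rewrite /top divn_small ?modn_small /=; try lia.
  by rewrite prednK //; lia.
rewrite raises_cons2; case: ifP => // H E.
have [//||N EN] := IH px; first by case: (raises p (v :: t)) E.
have [up|up] := ltnP u p; last first.
  by exists (N + p); rewrite top_full -?EN; [congr cons|]; lia.
move: H; rewrite up /= => /negbT; rewrite negb_or => /andP[v1].
have {}v1 : v = 1 by move: px => /andP[]; lia.
rewrite v1 eqseq_cons eqxx => /eqP t0.
case: t0; move: EN; rewrite v1; rewrite /top; case: (N %/ p) => /= [|q]; first by case.
by case=> Ep; lia.
Qed.

(** Only the part just before [top p N] can receive a unit. In the induction on [a], the first 1 of
    the run takes over the role of [i]. *)
Lemma raises_mi p k i a N : 1 < p -> i < p -> size (raises p (mi p k i a N)) = 1.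
Proof.
move=> p1; rewrite /mi; elim: k => [|k IH] ip; last first.
  by rewrite -[nseq _ _ ++ _]/(p :: (nseq k p ++ _)) raises_cons_full size_map IH.
elim: a i ip => [|a IH] i ip.
  rewrite /= raises_top cats0 /top.
  by case: (N %/ p) (N %% p) => [|q] [|r]; rewrite /= ip ?p1.
rewrite -[nseq 0 p ++ _]/[:: i, 1 & nseq a 1 ++ top p N] raises_cons2 ip.
rewrite size_cat size_map.
have -> : (1 < 1) || (1 :: nseq a 1 ++ top p N == [:: 1]) = false.
  by case: a {IH} => //=; rewrite /top; case: (N %/ p).
exact: IH.
Qed.

Lemma raises1 p x : 1 < p -> parts p x -> size (raises p x) = 1 ->
  exists k i a N, 0 < i < p /\ x = mi p k i a N.
Proof.
move=> p1; elim: x => // u [|v t] IH /andP[pu px] //.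
have [up|up] := ltnP u p; last first.
  have -> : u = p by lia.
  rewrite raises_cons_full size_map => /(IH px)[k [i [a [N [ip ->]]]]].
  by exists k.+1, i, a, N.
rewrite raises_cons2 up size_cat size_map.
case: ifP => [_ [/size0nil E]|/negbT].
  have [//|N ->] := @raises_eq0 p (v :: t) p1 px _ E.
  by exists 0, u, 0, N; split => //; lia.
(* The tail starts with 1, so its normal form has [k = 0] and [i = 1]; this 1 joins the run of ones
   following [u]. *)
rewrite negb_or => /andP[v1 t0] /(IH px)[k [i [a [N [ip E]]]]].
have {}v1 : v = 1 by move: px => /andP[]; lia.
case: k E => [|k]; last by case; lia.
by case=> _ ->; exists 0, u, a.+1, N; rewrite v1; split; [lia|].
Qed.

Lemma parts_mi p k i a N : 0 < i < p -> parts p (mi p k i a N).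
Proof.
move=> ip; rewrite all_cat /= all_cat all_rcons !all_nseq.
by have := @ltn_pmod N p; lia.
Qed.

Lemma sumn_mi p k i a N : sumn (mi p k i a N) = p * k + i + a + N.+1.
Proof.
rewrite sumn_cat /= sumn_cat sumn_rcons !sumn_nseq [in RHS](divn_eq N p).
lia.
Qed.

Lemma meet_irreducibles_mi n p x : 1 < p ->
  meet_irreducibles n p x <->
  exists k i a N, [/\ 0 < i < p, n = p * k + i + a + N.+1 & x = mi p k i a N].
Proof.
move=> p1; split=> [mx|[k [i [a [N [ip -> ->]]]]]].
  have [cx _] := mx; have [_ px sx] := cx.
  move/(meet_irreduciblesE p1 cx): mx => /(raises1 p1 px)[k [i [a [N [ip E]]]]].
  by exists k, i, a, N; rewrite -sx E sumn_mi.
apply/meet_irreduciblesE => //; last by apply: raises_mi; lia.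
split; [by case: k|exact: parts_mi|exact: sumn_mi].
Qed.

(** * The maps in the coordinates [(k, i, a, N)] *)

Lemma f_rcons p s u :
  f_ p (rcons s u) = if u < p then rcons s u.+1 else rcons (rcons s u) 1.
Proof.
case: s => [|v s] //=; rewrite last_rcons belast_rcons /=.
by case: ifP.
Qed.

Lemma f_mi p k i a N : 0 < p -> f_ p (mi p k i a N) = mi p k i a N.+1.
Proof.
move=> p0; rewrite /mi /top -rcons_cat -rcons_cons -rcons_cat f_rcons.
have lt_Np := ltn_pmod N p0.
have -> : N.+1 = N %/ p * p + (N %% p).+1 by rewrite addnS -divn_eq.
case: ifP => [lt_p|ge_p].
  rewrite divnMDl // modnMDl (divn_small lt_p) (modn_small lt_p) addn0.
  by rewrite !(rcons_cat, rcons_cons).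
(* The last part is full: a new part opens and the quotient of [N] by [p] grows by one. *)
have -> : (N %% p).+1 = p by lia.
rewrite divnMDl // modnMDl divnn modnn p0.
by rewrite !(rcons_cat, rcons_cons) nseqD cats1.
Qed.

Lemma psi_mi n p a b : 0 < p -> 0 < a < b -> b <= n -> 
  psi n p a b = mi p ((b - a) %/ p) ((b - a) %% p) a.-1 (n - b).
Proof.
move=> p0 ab; elim: n => [|n IH] bn; first by lia.
rewrite [LHS]/=; case: ifP => [lt_b|ge_b].
  by rewrite IH ?f_mi // subSn.
have -> : b = n.+1 by lia.
(* For [b = n], the last of the [a] trailing ones is [top p 0]. *)
rewrite subnn /mi /top div0n mod0n; congr (_ ++ _ :: _).
by case: a ab {IH} => // a _; rewrite -[a.+1 in LHS]addn1 nseqD.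
Qed.

(** If [N = 0], the final [top p 0 = [:: 1]] is counted by [m_]; otherwise [top p N] starts with a
    part above 1 and [delta_] supplies the missing unit. The sum is [a.+1] either way. *)
Lemma Phi_mi p k i a N : 0 < i < p ->
  Phi p (mi p k i a N) = [fset a.+1; (p * k + i + a.+1)%N]%fset.
Proof.
move=> ip.
have Ek : k_ p (mi p k i a N) = k.
  rewrite /k_ /mi find_cat has_nseq size_nseq /= eqxx andbF.
  have -> : i != p by lia.
  by rewrite addn0.
have Ei : i_ p (mi p k i a N) = i.
  by rewrite /i_ Ek /mi nth_cat size_nseq ltnn subnn.
have Emd : m_ p (mi p k i a N) + delta_ p (mi p k i a N) = a.+1.
  have -> : m_ p (mi p k i a N) = a + (N == 0).
    rewrite /m_ Ek /mi -cat_rcons drop_size_cat ?size_rcons ?size_nseq //.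
    rewrite find_cat has_nseq size_nseq /= andbF /top; congr addn.
    case: (eqVneq N 0) => [->|N0]; first by rewrite div0n mod0n.
    have := divn_eq N p; case: (N %/ p) => [|q] /=; last by case: ifP => //; lia.
    by case: (N %% p) => //=; lia.
  have -> : delta_ p (mi p k i a N) = (N != 0).
    rewrite /delta_ /mi /top last_cat /= last_cat last_rcons eqSS.
    rewrite /suffix !(rev_cat, rev_cons, rev_rcons, rev_nseq).
    have := divn_eq N p; case: (N %% p) => [|r] /= E; last by rewrite -lt0n E addnS.
    case: (N %/ p) E => [|q] /= E; last by rewrite eqxx prefix0s E addn0 muln_eq0; lia.
    by case: a {Ek Ei} => [|a] /=; rewrite prefix0s; lia.
  by case: (N == 0); rewrite /= ?addn0 ?addn1.
by rewrite /Phi Ek Ei -addnA Emd.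
Qed.

(** * Edges as ordered pairs, and the two inverse identities *)

Lemma Psi_fset2 n p a b : a < b -> Psi n p [fset a; b]%fset = psi n p a b.
Proof.
move=> ab; rewrite /Psi.
suff -> : sort leq [fset a; b]%fset = [:: a; b] by [].
apply: (sorted_eq leq_trans anti_leq).
- exact: sort_sorted leq_total _.
- by rewrite /= (ltnW ab).
rewrite perm_sort; apply: uniq_perm; first exact: fset_uniq.
  by rewrite /= inE; lia.
by move=> x; rewrite !inE.
Qed.

Lemma turan_edgesP n p e : turan_edges n p e ->
  exists a b, [/\ 0 < a < b, b <= n, 0 < (b - a) %% p & e = [fset a; b]%fset].
Proof.
case=> a [b [an bn nab ->]].
wlog ab : a b an bn nab / a < b.
  move=> W; have [lt|lt|E] := ltngtP a b; first exact: W.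
    by rewrite fsetUC; apply: W => // E; apply: nab.
  by case: nab; rewrite E.
exists a, b; split; [lia|lia| |by []].
rewrite lt0n; apply/negP; rewrite -[_ == 0]eqn_mod_dvd => [/eqP E|]; last lia.
exact: nab.
Qed.

Lemma Psi_edge n p e : 1 < p -> turan_edges n p e ->
  meet_irreducibles n p (Psi n p e) /\ Phi p (Psi n p e) = e.
Proof.
move=> p1 /turan_edgesP[a [b [ab bn mod0 ->]]].
(* This remainder is the coordinate [i]: incongruence of the endpoints is exactly its positivity. *)
have modp : 0 < (b - a) %% p < p by rewrite mod0 ltn_mod; lia.
rewrite Psi_fset2 ?psi_mi; try lia.
have E := divn_eq (b - a) p.
split.
  apply/(meet_irreducibles_mi _ _ p1).
  exists ((b - a) %/ p), ((b - a) %% p), a.-1, (n - b); split=> //; lia.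
by rewrite Phi_mi //; congr [fset _; _]%fset; lia.
Qed.

Lemma Phi_meet_irreducible n p x : 1 < p -> meet_irreducibles n p x ->
  turan_edges n p (Phi p x) /\ Psi n p (Phi p x) = x.
Proof.
move=> p1 /(meet_irreducibles_mi _ _ p1)[k [i [a [N [ip En ->]]]]].
rewrite Phi_mi //; split.
  exists a.+1, (p * k + i + a.+1); split=> //; try lia.
  move=> /eqP; rewrite eq_sym eqn_mod_dvd ?addnK ?leq_addl //.
  rewrite dvdn_addr ?dvdn_mulr // => /dvdn_leq; lia.
rewrite Psi_fset2 ?psi_mi ?addnK; try lia.
have E : (p * k + i) %/ p = k by rewrite mulnC divnMDl ?divn_small; lia.
have E' : (p * k + i) %% p = i by rewrite mulnC modnMDl modn_small; lia.
by rewrite E E' En /=; congr mi; lia.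
Qed.

Theorem theorem2p4 (n p : nat) (hn : 2 <= n) (hp : 2 <= p) :
  [/\ set_bij (turan_edges n p) (meet_irreducibles n p) (Psi n p),
      set_bij (meet_irreducibles n p) (turan_edges n p) (Phi p),
      {in turan_edges n p, cancel (Psi n p) (Phi p)} &
      {in meet_irreducibles n p, cancel (Phi p) (Psi n p)}].
Proof.
have P e := @Psi_edge n p e hp; have Q x := @Phi_meet_irreducible n p x hp.
have PK : {in turan_edges n p, cancel (Psi n p) (Phi p)}.
  by move=> e /set_mem /P[].
have QK : {in meet_irreducibles n p, cancel (Phi p) (Psi n p)}.
  by move=> x /set_mem /Q[].
split=> //; split.
- by move=> e /P[].
- exact: (can_in_inj PK).
- by move=> x /Q[ex Ex]; exists (Phi p x).
- by move=> x /Q[].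
- exact: (can_in_inj QK).
- by move=> e /P[xe Ee]; exists (Psi n p e).
Qed.
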